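(* Let $(\mathcal{A},\phi)$ be a non-commutative probability space and let $\mathcal{A}^\circ=\mathcal{A}\setminus\ker\phi$. If $X,Y\in\mathcal{A}^\circ$ are free, then $T_{XY}=T_XT_Y$ (equality of formal power series in $z$), where $T_X(z)=\sum_{n=0}^\infty t_n(X)z^n$ denotes the $T$-transform.
   Context: A non-commutative probability space is a couple $(\mathcal{A},\phi)$, where $\mathcal{A}$ is a unital ($*$-)algebra over $\mathbb{C}$ and $\phi:\mathcal{A}\to\mathbb{C}$ is a linear map with $\phi(1)=1$ (and $\phi(x^*x)\ge 0$ for all $x\in\mathcal{A}$ if $\mathcal{A}$ is a $*$-algebra). A family $\{\mathcal{A}_i\}_{i\in I}$ of unital ($*$-)subalgebras of $\mathcal{A}$ is free if $\phi(a_1a_2\cdots a_n)=0$ whenever $n\ge 1$, $a_k\in\mathcal{A}_{\varepsilon(k)}$, $\varepsilon(j)\ne\varepsilon(j+1)$ for $1\le j\le n-1$, and $\phi(a_k)=0$ for all $k$. Elements of $\mathcal{A}$ are free if the unital ($*$-)subalgebras they generate are free ($*$-subalgebras when $\mathcal{A}$ is a $*$-algebra, subalgebras otherwise). A non-crossing linked partition $\pi$ of $\{1,\dots,n\}$ is a collection $B_1,\dots,B_k$ of distinct nonempty subsets (blocks) of $\{1,\dots,n\}$ such that: (a) $\bigcup_{l=1}^k B_l=\{1,\dots,n\}$; (b) there are no two distinct blocks $B_l,B_s$ and $i<m<p<q$ with $i,p\in B_l$ and $m,q\in B_s$; (c) for any two distinct blocks $B_l,B_s$, the intersection $B_l\cap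 B_s$ is either empty or contains only one element, and if $\{j\}=B_l\cap B_s$ then $|B_l|,|B_s|\ge 2$ and $j$ is the minimal element of exactly one of the blocks $B_l$ and $B_s$. The set of all of these is $NCL(n)$. For $\pi\in NCL(n)$, $s(\pi)$ denotes the set of all $k\in\{1,\dots,n\}$ such that no block of $\pi$ has minimal element $k$. The $t$-coefficients are the maps $t_n:\mathcal{A}\times(\mathcal{A}^\circ)^n\to\mathbb{C}$, $n\ge 0$, determined by the recurrence $$\phi(X_1\cdots X_n)=\sum_{\pi\in NCL(n)}\Big(\prod_{\substack{B\text{ block of }\pi\\ B=(i_1<\dots<i_l)}}t_{l-1}(X_{i_1},\dots,X_{i_l})\cdot\prod_{k\in s(\pi)}t_0(X_k)\Big)$$ for all $n\ge1$, $X_1\in\mathcal{A}$, $X_2,\dots,X_n\in\mathcal{A}^\circ$. In particular $t_0=\phi$. The recurrence determines the maps because $t_{n-1}(X_1,\dots,X_n)$ occurs only in the term of the one-block partition, with nonzero coefficient $\prod_{l=2}^n t_0(X_l)$. For $X\in\mathcal{A}^\circ$ write $t_n(X)=t_n(X,\dots,X)$ ($n+1$ arguments). *)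

(* Defs.v *)
From mathcomp Require Import boolp classical_sets reals.
(* Imported after [classical_sets], so that [set0] and [setT] are the ones of
   [finset]. *)
From mathcomp Require Import all_boot all_order all_algebra complex.

Set Implicit Arguments.
Unset Strict Implicit.
Unset Printing Implicit Defensive.

Import Order.TTheory GRing.Theory Num.Theory.
Local Open Scope ring_scope.
Local Open Scope complex_scope.

Section NCProbSpace.
Variables (R : realType) (A : algType R[i]).

Definition star_operation (s : A -> A) : Prop :=
  [/\ involutive s,
      {morph s : x y / x + y},
      (forall (a : R[i]) (x : A), s (a *: x) = Num.conj a *: s x) &
      (forall x y : A, s (x * y) = s y * s x)].

(* [star = None] is the case of a plain unital algebra, [star = Some s] that of
   a *-algebra with involution [s].  In the order of [R[i]], [0 <= z] means that
   [z] is real and nonnegative. *)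
Definition nc_probability_space (star : option (A -> A)) (phi : {scalar A}) :
    Prop :=
  phi 1 = 1 /\
  if star is Some s then
    star_operation s /\ forall x : A, 0 <= phi (s x * x)
  else True.

Definition unital_subalgebra (star : option (A -> A)) (S : set A) : Prop :=
  GRing.subalg_closed [in S] /\
  if star is Some s then forall x, S x -> S (s x) else True.

Definition generated_subalgebra (star : option (A -> A)) (G : set A) : set A :=
  smallest (unital_subalgebra star) G.

(* Only the values of [eps] and [a] below [n] matter. *)
Definition free_family (phi : A -> R[i]) (I : Type) (S : I -> set A) : Prop :=
  forall (n : nat) (eps : nat -> I) (a : nat -> A),
    (0 < n)%N ->
    (forall k, (k < n)%N -> S (eps k) (a k)) ->
    (forall k, (k.+1 < n)%N -> eps k <> eps k.+1) ->
    (forall k, (k < n)%N -> phi (a k) = 0) ->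
    phi (\prod_(k < n) a k) = 0.

Definition free_elements (star : option (A -> A)) (phi : A -> R[i])
    (I : Type) (x : I -> A) : Prop :=
  free_family phi (fun i => generated_subalgebra star [set x i]%classic).

Definition free_pair (star : option (A -> A)) (phi : A -> R[i]) (X Y : A) :
    Prop :=
  free_elements star phi (fun b : bool => if b then X else Y).

End NCProbSpace.

(* Partitions of {1, ..., n} are shifted to {0, ..., n-1}. *)
Section NonCrossingLinked.
Variable n : nat.
Implicit Types (B : {set 'I_n}) (pi : {set {set 'I_n}}).

Definition is_min (j : 'I_n) B : bool :=
  (j \in B) && [forall i in B, (j <= i)%N].

Definition crossing B B' : bool :=
  [exists i in B, exists m in B', exists p in B, exists q in B',
    [&& (i < m)%N, (m < p)%N & (p < q)%N]].

Definition linked B B' : bool :=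
  (B :&: B' == set0) ||
  [exists j, [&& B :&: B' == [set j], (2 <= #|B|)%N, (2 <= #|B'|)%N
                & is_min j B (+) is_min j B']].

Definition NCL : {set {set {set 'I_n}}} :=
  [set pi : {set {set 'I_n}} |
    [&& set0 \notin pi,
        cover pi == setT,
        [forall B in pi, forall B' in pi, (B != B') ==> ~~ crossing B B'] &
        [forall B in pi, forall B' in pi, (B != B') ==> linked B B']]].

Definition non_minima pi : {set 'I_n} :=
  [set k | ~~ [exists B in pi, is_min k B]].

End NonCrossingLinked.

Section TCoefficients.
Variables (R : realType) (A : algType R[i]).

(* A family of maps [t_n : A * A^n -> C] is encoded as [t : A -> seq A -> C],
   with [t_n(x_0, x_1, ..., x_n) = t x_0 [:: x_1; ...; x_n]]. *)
Implicit Type t : A -> seq A -> R[i].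

(* [enum B] lists the block in increasing order. *)
Definition t_block t n (X : 'I_n -> A) (B : {set 'I_n}) : R[i] :=
  if enum B is i :: s then t (X i) [seq X j | j <- s] else 1.

Definition t_term t n (X : 'I_n -> A) (pi : {set {set 'I_n}}) : R[i] :=
  (\prod_(B in pi) t_block t X B) * \prod_(k in non_minima pi) t (X k) [::].

(* This fixes [t x s] only when the entries of [s] lie outside the kernel of
   [phi]; the other values of [t] play no role. *)
Definition t_coefficients (phi : A -> R[i]) t : Prop :=
  forall (n : nat) (X : 'I_n.+1 -> A),
    (forall i, i != ord0 -> phi (X i) != 0) ->
    phi (\prod_(i < n.+1) X i) = \sum_(pi in NCL n.+1) t_term t X pi.

(* A formal power series is the sequence of its coefficients. *)
Definition fps : Type := nat -> R[i].

Definition fps_mul (f g : fps) : fps :=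
  fun n => \sum_(k < n.+1) f k * g (n - k)%N.

Definition T_transform t (X : A) : fps := fun n => t X (nseq n X).

End TCoefficients.

(* The recurrence is solvable, so that assuming [t_coefficients phi t] is never
   vacuous. *)
Lemma one_block_NCL n : [set [set: 'I_n.+1]] \in NCL n.+1.
Proof.
rewrite inE; apply/and4P; split.
- by rewrite inE eq_sym; apply/set0Pn; exists ord0; rewrite inE.
- by rewrite /cover big_set1.
- apply/forall_inP => B; rewrite inE => /eqP ->.
  by apply/forall_inP => B'; rewrite inE => /eqP ->; rewrite eqxx.
- apply/forall_inP => B; rewrite inE => /eqP ->.
  by apply/forall_inP => B'; rewrite inE => /eqP ->; rewrite eqxx.
Qed.

Lemma NCL_setT n (pi : {set {set 'I_n.+1}}) :
  pi \in NCL n.+1 -> setT \in pi -> pi = [set setT].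
Proof.
rewrite inE => /and4P[pi0 _ _ /forall_inP h] piT.
apply/setP => B; rewrite inE; apply/idP/eqP => [piB|->//].
apply/eqP; apply: contraT => neB.
have := implyP (forall_inP (h _ piB) _ piT) neB; rewrite /linked setIT.
case/orP => [/eqP B0|/existsP[j /and4P[/eqP -> ]]]; last by rewrite cards1.
by rewrite B0 (negPf pi0) in piB.
Qed.

Lemma NCL1 (pi : {set {set 'I_1}}) : pi \in NCL 1 -> pi = [set setT].
Proof.
move=> hpi; apply: NCL_setT => //.
move: hpi; rewrite inE => /and4P[pi0 /eqP cpi _ _].
have : ord0 \in cover pi by rewrite cpi inE.
case/bigcupP => B piB B0; suff <- : B = setT by [].
by apply/setP => i; rewrite inE (ord1 i) B0.
Qed.

Section TCoefficientsExist.
Variables (R : realType) (A : algType R[i]) (phi : {scalar A}).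
Implicit Types (t : A -> seq A -> R[i]) (x : A) (s : seq A).

Lemma t_term_one_block t x s :
  t_term t (fun i : 'I_(size s).+1 => nth 0 (x :: s) i) [set setT] =
  t x s * \prod_(y <- s) t y [::].
Proof.
rewrite /t_term big_set1; congr (_ * _).
  have -> : t_block t (fun i : 'I_(size s).+1 => nth 0 (x :: s) i) setT =
      if enum 'I_(size s).+1 is i :: r
      then t (nth 0 (x :: s) i) [seq nth 0 (x :: s) (j : 'I__) | j <- r] else 1.
    by rewrite /t_block enum_setT enumT.
  rewrite enum_ordSl /= -map_comp; congr (t x _).
  rewrite -[RHS](mkseq_nth 0) /mkseq -val_enum_ord -map_comp.
  exact: eq_map.
have -> : non_minima [set [set: 'I_(size s).+1]] = [set k | k != ord0].
  apply/setP => k; rewrite !inE; congr (~~ _).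
  apply/existsP/eqP => [[B]|->].
    rewrite inE => /andP[/eqP-> /andP[_ /forall_inP/(_ ord0)]].
    rewrite inE leqn0 => /(_ isT) /eqP k0.
    exact: val_inj.
  exists setT; rewrite inE eqxx /is_min inE /=.
  by apply/forall_inP => i _.
under eq_bigl do rewrite inE.
rewrite [RHS](big_nth 0) big_mkord [LHS]big_mkcond big_ord_recl /= mul1r.
by apply: eq_bigr => i _.
Qed.

Lemma eq_t_term t t' n (X : 'I_n.+1 -> A) (pi : {set {set 'I_n.+1}}) :
  (forall x s, (size s < n)%N -> t x s = t' x s) ->
  pi \in NCL n.+1 -> pi != [set setT] -> t_term t X pi = t_term t' X pi.
Proof.
move=> tt' hpi ne.
have n0 : (0 < n)%N.
  case: n X pi tt' hpi ne => // X pi _ /NCL1 ->.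
  by rewrite eqxx.
congr (_ * _); last by apply: eq_bigr => k _; exact: tt'.
apply: eq_bigr => B piB; rewrite /t_block.
have : (size (enum B) < n.+1)%N.
  rewrite -cardE -[X in (_ < X)%N]card_ord -cardsT; apply: proper_card.
  rewrite properT; apply: contraNneq ne => BT.
  by apply/eqP/NCL_setT => //; rewrite -BT.
case: (enum B) => //= i r lt_r.
by apply: tt'; rewrite size_map.
Qed.

Fixpoint t_fuel (m : nat) x s : R[i] :=
  if m isn't m'.+1 then phi x else
    (phi (\prod_(y <- x :: s) y) -
     \sum_(pi in NCL (size s).+1 | pi != [set setT])
       t_term (t_fuel m') (fun i => nth 0 (x :: s) i) pi) /
    \prod_(y <- s) phi y.

Lemma t_fuel_nil m x : t_fuel m x [::] = phi x.
Proof.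
case: m => //= m; rewrite big_cons !big_nil mulr1 divr1 big1 ?subr0 //.
by move=> pi /andP[/NCL1 -> ]; rewrite eqxx.
Qed.

Lemma t_fuel_stable m x s : (size s <= m)%N -> t_fuel m x s = t_fuel (size s) x s.
Proof.
elim/ltn_ind: m x s => -[_ x [|//]|m IH x s]; first by rewrite t_fuel_nil.
case: s => [_|z s le_m]; first by rewrite !t_fuel_nil.
rewrite /=; congr ((_ - _) / _).
apply: eq_bigr => pi /andP[hpi ne]; apply: eq_t_term => // y r lt_r.
rewrite IH //; last by apply: leq_trans lt_r le_m.
by rewrite [RHS]IH.
Qed.

Lemma t_coefficients_exist : exists t, t_coefficients phi t.
Proof.
pose t x s := t_fuel (size s) x s.
suff ht x s : all (fun y => phi y != 0) s ->
    phi (\prod_(i < (size s).+1) nth 0 (x :: s) i) =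
    \sum_(pi in NCL (size s).+1) t_term t (fun i => nth 0 (x :: s) i) pi.
  exists t => n X X0.
  pose s := [seq X (lift ord0 i) | i <- enum 'I_n].
  have es : n = size s by rewrite size_map size_enum_ord.
  have eX : X = (fun i => nth 0 (X ord0 :: s) i).
    apply: funext => i; case: (unliftP ord0 i) => [j ->|->] //=.
    rewrite (nth_map j) //.
      exact: (congr1 (fun k => X (lift ord0 k)) (esym (@nth_ord_enum n j j))).
    by rewrite size_enum_ord; exact: ltn_ord.
  have s0 : all (fun y => phi y != 0) s.
    by rewrite all_map; apply/allP => k _; apply: X0.
  rewrite eX; move: (X ord0) s0 es => x.
  move: (s) => {eX X0}s0 hs0 es; case: _ / (esym es) {X s}.
  exact: ht.
move=> s0; rewrite (bigD1 _ (one_block_NCL _)) /= t_term_one_block.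
have p0 : \prod_(y <- s) phi y != 0.
  rewrite prodf_seq_neq0; apply/allP => y ys.
  exact: (allP s0).
have -> : \prod_(y <- s) t y [::] = \prod_(y <- s) phi y by [].
have -> : \prod_(i < (size s).+1) nth 0 (x :: s) i = \prod_(y <- x :: s) y.
  by rewrite [RHS](big_nth 0) big_mkord.
rewrite {1}/t -(@t_fuel_stable (size s).+1) //=.
rewrite divfK // -[LHS](subrK (\sum_(pi in NCL (size s).+1 | pi != [set setT])
       t_term t (fun i => nth 0 (x :: s) i) pi)).
congr (_ - _ + _); apply: eq_bigr => pi /andP[hpi ne].
apply: eq_t_term => // y r lt_r.
by rewrite /t (@t_fuel_stable (size s)) // ltnW.
Qed.

End TCoefficientsExist.

(* Main.v *)
From HB Require Import structures.
Require Import Defs.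
From mathcomp Require Import boolp classical_sets reals functions.
From mathcomp Require Import all_boot all_order all_algebra complex.
From mathcomp Require Import zify ring.
Import Order.TTheory GRing.Theory Num.Theory.
Local Open Scope ring_scope.
Local Open Scope complex_scope.

Set Implicit Arguments.
Unset Strict Implicit.
Unset Printing Implicit Defensive.

(** The [t]-coefficients of one element [x] are encoded in its moment series
    [M(z) = \sum_n phi (x ^+ n) z^n] through the equation
    [M = 1 + z * M * T_x(M - 1)].  Equivalently, writing [w = M - 1], the series
    [chi_x(w) = w / ((1 + w) * T_x(w))] satisfies [M(chi_x(w)) = 1 + w]; it is
    the compositional inverse of [M - 1], and [1 / T_x] is the S-transform.

    To obtain this from the recurrence, a non-crossing linked partition is read
    as a non-crossing forest: every vertex opens at most one block, and in any
    other block it belongs to, it is a child of the minimum of that block.  A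
    vertex with [c] children then has weight [t_c(x)] ([moment_forests]).
    Forests are grown one vertex at a time.  The sum of the weights of all
    extensions of a forest has a closed product form, in which every vertex
    that can still receive children contributes a tail of [T_x]; that this form
    satisfies the one-step recursion is a telescoping sum
    ([forest_gf_step]), and for the empty forest it reads [1 + w]
    ([forest_comp]).

    Freeness enters through resolvents with power series coefficients.  With
    [a = (1 - chi_X X)^-1] and [b = (1 - chi_Y Y)^-1], both of [phi]-value
    [1 + w], put [a = 1 + w + w p] and [b = 1 + w + w q] with [p], [q] centered.
    At [s = chi_X * chi_Y * (1 + w) / w] the linear terms of
    [a (1 - s X Y) b] cancel and leave [(1 + w) - w p q]
    ([resolvent_product]).  So [(1 - s X Y)^-1] is [b], times a geometric series
    in [p q], times [a], up to the factor [1 + w]; its [phi]-value is [1 + w],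
    since alternating products of [p] and [q] vanish under [phi]
    ([ps_phi_sandwich], [free_comp_mul]).  Both [s] and [chi_(X Y)] are thus
    solutions of [M_(X Y)(chi) = 1 + w].  The solution is unique because
    [phi (X * Y) = phi X * phi Y] is nonzero ([ps_comp_inj]), and
    [s = chi_(X Y)] is the identity [T_(X Y) = T_X * T_Y]. *)

(** * Formal power series *)

(** The alias keeps the Cauchy product apart from the pointwise product that
    functions into a ring carry. *)
Definition pseries (B : Type) : Type := nat -> B.

HB.instance Definition _ (B : zmodType) :=
  GRing.Zmodule.copy (pseries B) (nat -> B).

Section PowerSeriesRing.
Variable B : nzRingType.
Implicit Types f g h : pseries B.

Lemma addsE f g n : (f + g) n = f n + g n. Proof. by []. Qed.
Lemma subsE f g n : (f - g) n = f n - g n. Proof. by []. Qed.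

Lemma sumsE (I : Type) (r : seq I) (P : pred I) (F : I -> pseries B) n :
  (\sum_(i <- r | P i) F i) n = \sum_(i <- r | P i) F i n.
Proof. by elim/big_rec2: _ => // i y1 y2 _ <-. Qed.

Definition ps_const (c : B) : pseries B := fun n => if n is 0%N then c else 0.

Definition ps_mul f g : pseries B :=
  fun n => \sum_(k < n.+1) f k * g (n - k)%N.

Definition ps_trunc m f : {poly B} := \poly_(i < m) f i.

Lemma coef_ps_trunc m f n : (n < m)%N -> (ps_trunc m f)`_n = f n.
Proof. by move=> nm; rewrite coef_poly nm. Qed.

(** Coefficients below [m] of a product are those of the product of the
    truncations, so the ring axioms come from those of polynomials. *)
Lemma ps_mul_trunc m f g n : (n < m)%N ->
  ps_mul f g n = (ps_trunc m f * ps_trunc m g)`_n.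
Proof.
move=> nm; rewrite coefM; apply: eq_bigr => k _.
by rewrite !coef_ps_trunc //; have := ltn_ord k; lia.
Qed.

Lemma ps_mulA : associative ps_mul.
Proof.
move=> f g h; apply/funext => n; set m := n.+1.
have E (p q : {poly B}) (p' q' : pseries B) :
    (forall i, (i <= n)%N -> p`_i = p' i) ->
    (forall i, (i <= n)%N -> q`_i = q' i) -> ps_mul p' q' n = (p * q)`_n.
  move=> pp qq; rewrite coefM; apply: eq_bigr => k _.
  by rewrite pp ?qq //; have := ltn_ord k; lia.
have T u i : (i <= n)%N -> (ps_trunc m u)`_i = u i.
  by move=> ?; rewrite coef_ps_trunc.
have M u v i : (i <= n)%N -> (ps_trunc m u * ps_trunc m v)`_i = ps_mul u v i.
  by move=> ?; rewrite -ps_mul_trunc.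
by rewrite (E _ _ _ _ (T f) (M g h)) (E _ _ _ _ (M f g) (T h)) mulrA.
Qed.

Lemma ps_mul1s : left_id (ps_const 1) ps_mul.
Proof.
move=> f; apply/funext => n; rewrite /ps_mul big_ord_recl /= mul1r subn0.
by rewrite big1 ?addr0 // => i _; rewrite mul0r.
Qed.

Lemma ps_muls1 : right_id (ps_const 1) ps_mul.
Proof.
move=> f; apply/funext => n; rewrite /ps_mul big_ord_recr /= subnn mulr1.
rewrite big1 ?add0r // => i _; case E: (n - i)%N => /=; rewrite ?mulr0 //.
by have := ltn_ord i; lia.
Qed.

Lemma ps_mulDl : left_distributive ps_mul +%R.
Proof.
move=> f g h; apply/funext => n; rewrite /ps_mul addsE -big_split /=.
by apply: eq_bigr => k _; rewrite addsE mulrDl.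
Qed.

Lemma ps_mulDr : right_distributive ps_mul +%R.
Proof.
move=> f g h; apply/funext => n; rewrite /ps_mul addsE -big_split /=.
by apply: eq_bigr => k _; rewrite addsE mulrDr.
Qed.

Lemma ps_const1_neq0 : ps_const 1 != 0.
Proof. by apply/eqP => /(congr1 (@^~ 0%N)) /eqP; apply/negP/oner_neq0. Qed.

HB.instance Definition _ := GRing.Zmodule_isNzRing.Build (pseries B)
  ps_mulA ps_mul1s ps_muls1 ps_mulDl ps_mulDr ps_const1_neq0.

Lemma mulsE f g n : (f * g) n = \sum_(k < n.+1) f k * g (n - k)%N.
Proof. by []. Qed.

Lemma mulsE0 f g : (f * g) 0%N = f 0%N * g 0%N.
Proof. by rewrite mulsE big_ord1. Qed.

Definition psX : pseries B := fun n => (n == 1%N)%:R.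

Lemma psX_mulE f n : (psX * f) n = if n is m.+1 then f m else 0.
Proof.
rewrite mulsE; case: n => [|n]; first by rewrite big_ord1 mul0r.
rewrite big_ord_recl mul0r add0r big_ord_recl mul1r /= subSS subn0.
by rewrite big1 ?addr0 // => i _; rewrite mul0r.
Qed.

Lemma psX_mulI f g : psX * f = psX * g -> f = g.
Proof.
move=> fg; apply/funext => n.
by have := congr1 (@^~ n.+1) fg; rewrite /= !psX_mulE.
Qed.

Lemma eq_muls f f' g g' n :
  (forall i, (i <= n)%N -> f i = f' i) -> (forall i, (i <= n)%N -> g i = g' i) ->
  (f * g) n = (f' * g') n.
Proof.
move=> ff gg; rewrite !mulsE; apply: eq_bigr => k _.
by have := ltn_ord k => ?; rewrite ff ?gg //; lia.
Qed.

Lemma exps_order f k n : f 0%N = 0 -> (n < k)%N -> (f ^+ k) n = 0.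
Proof.
move=> f0; elim: k n => // k IH n nk; rewrite exprS mulsE big1 // => -[i /= ik] _.
by case: i ik => [|i] ik; rewrite ?f0 ?mul0r // IH ?mulr0 //; lia.
Qed.

(** The series [\sum_k f ^+ k] for [f] without constant term: as [f ^+ k] has
    order at least [k], the terms with [k > n] do not reach the coefficient of
    index [n]. *)
Definition geometric f : pseries B := fun n => (\sum_(k < n.+1) f ^+ k) n.

Lemma geometricE f m n : f 0%N = 0 -> (n < m)%N ->
  geometric f n = (\sum_(k < m) f ^+ k) n.
Proof.
move=> f0 nm; rewrite /geometric (big_ord_widen _ (GRing.exp f) nm) big_mkcond.
rewrite !sumsE; apply: eq_bigr => k _.
by case: ifP => // kn; rewrite exps_order //; lia.
Qed.

Lemma mul_geometric f : f 0%N = 0 -> (1 - f) * geometric f = 1.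
Proof.
move=> f0; apply/funext => n.
rewrite (@eq_muls _ (1 - f) _ (\sum_(k < n.+1) f ^+ k)) //; last first.
  by move=> i i_n; exact: geometricE.
have -> : (1 - f) * \sum_(k < n.+1) f ^+ k = 1 - f ^+ n.+1.
  by rewrite -[in RHS]opprB subrX1 -mulNr opprB.
by rewrite subsE exps_order // subr0.
Qed.

Lemma geometric_mul f : f 0%N = 0 -> geometric f * (1 - f) = 1.
Proof.
move=> f0; apply/funext => n.
rewrite (@eq_muls _ (\sum_(k < n.+1) f ^+ k) _ (1 - f)) //; last first.
  by move=> i i_n; exact: geometricE.
have -> : (\sum_(k < n.+1) f ^+ k) * (1 - f) = 1 - f ^+ n.+1.
  rewrite -[in RHS]opprB subrX1 -mulNr opprB; apply: commr_sym.
  by apply: commr_sum => i _; apply/commrX/commr_sym/commrB => //; exact: commr1.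
by rewrite subsE exps_order // subr0.
Qed.

End PowerSeriesRing.
Arguments psX {B}.

Lemma ps_mulC (C : comNzRingType) : commutative (@ps_mul C).
Proof.
move=> f g; apply/funext => n.
by rewrite !(@ps_mul_trunc _ n.+1) // mulrC.
Qed.

HB.instance Definition _ (C : comNzRingType) :=
  GRing.PzRing_hasCommutativeMul.Build (pseries C) (@ps_mulC C).

(** Over a field a series with nonzero constant term is invertible: up to a
    scalar it is [1 - u] with [u] without constant term. *)
Lemma ps_inv (F : fieldType) (f : pseries F) : f 0%N != 0 ->
  exists g : pseries F, f * g = 1.
Proof.
move=> f0; pose c := ps_const (f 0%N)^-1.
have cf0 : (1 - c * f) 0%N = 0 by rewrite subsE mulsE0 /= mulVf // subrr.
exists (c * geometric (1 - c * f)).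
by rewrite mulrCA mulrA -{1}[c * f](subKr 1) mul_geometric.
Qed.

(** * Power series over an algebra *)

Section PowerSeriesAlgebra.
Variables (C : comNzRingType) (A : algType C).
Implicit Types (k l : pseries C) (f g : pseries A).

(** Coefficientwise embedding of the scalars; its image is central, so that the
    power series over [A] form an algebra over the power series over [C]. *)
Definition ps_alg k : pseries A := fun n => (k n)%:A.
Definition ps_scale k f : pseries A := ps_alg k * f.

Lemma ps_scaleE k f n : ps_scale k f n = \sum_(i < n.+1) k i *: f (n - i)%N.
Proof. by rewrite /ps_scale mulsE; apply: eq_bigr => i _; rewrite mulr_algl. Qed.

Lemma ps_algM k l : ps_alg (k * l) = ps_alg k * ps_alg l.
Proof.
apply/funext => n; rewrite /ps_alg !mulsE scaler_suml; apply: eq_bigr => i _.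
by rewrite -scalerAl mul1r scalerA.
Qed.

Lemma ps_alg_comm k f : ps_alg k * f = f * ps_alg k.
Proof.
apply/funext => n; rewrite !mulsE [RHS](reindex_inj rev_ord_inj) /=.
apply: eq_bigr => i _; rewrite /ps_alg mulr_algl mulr_algr.
by rewrite !subSS subKn // -ltnS.
Qed.

Lemma ps_scaleA k l f : ps_scale k (ps_scale l f) = ps_scale (k * l) f.
Proof. by rewrite /ps_scale mulrA ps_algM. Qed.

Lemma ps_scale1 : left_id 1 ps_scale.
Proof.
move=> f; rewrite /ps_scale; have -> : ps_alg 1 = 1; last exact: mul1r.
by apply/funext => -[|n]; rewrite /ps_alg ?scale1r ?scale0r.
Qed.

Lemma ps_scaleDr : right_distributive ps_scale +%R.
Proof. by move=> k f g; rewrite /ps_scale mulrDr. Qed.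

Lemma ps_scaleDl f : {morph ps_scale^~ f : k l / k + l}.
Proof.
move=> k l; rewrite /ps_scale -mulrDl; congr (_ * _).
by apply/funext => n; rewrite /ps_alg addsE scalerDl.
Qed.

HB.instance Definition _ := GRing.Zmodule_isLmodule.Build (pseries C) (pseries A)
  ps_scaleA ps_scale1 ps_scaleDr ps_scaleDl.

Lemma scalesE k f n : (k *: f) n = \sum_(i < n.+1) k i *: f (n - i)%N.
Proof. exact: ps_scaleE. Qed.

Lemma ps_scaleAl k f g : k *: (f * g) = k *: f * g.
Proof. exact: mulrA. Qed.

HB.instance Definition _ :=
  GRing.Lmodule_isLalgebra.Build (pseries C) (pseries A) ps_scaleAl.

Lemma ps_scaleAr k f g : k *: (f * g) = f * (k *: g).
Proof.
have E h : k *: h = ps_alg k * h by [].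
by rewrite !E !mulrA (ps_alg_comm k f).
Qed.

HB.instance Definition _ :=
  GRing.Lalgebra_isAlgebra.Build (pseries C) (pseries A) ps_scaleAr.

Lemma scales0 k f : (k *: f) 0%N = k 0%N *: f 0%N.
Proof. by rewrite scalesE big_ord1. Qed.

End PowerSeriesAlgebra.

(** * Non-crossing forests *)

(** A forest on [0, ..., size s - 1] whose edges go from a smaller parent to a
    larger child is coded by its parent function: entry [j] of [s] is the
    parent of [j], or [j] itself when [j] is a root.  The new vertex [size s]
    may become a child of [v], or a root when [v = size s], if the edge from [v]
    crosses no edge of [s]. *)
Definition attachable (s : seq nat) (v : nat) : bool :=
  (v <= size s)%N &&
  all (fun p => (v <= nth 0%N s p)%N || (p <= v)%N) (iota 0 (size s)).

Fixpoint nc_forests (n : nat) : seq (seq nat) :=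
  if n is m.+1 then
    [seq rcons s v | s <- nc_forests m, v <- [seq v <- iota 0 m.+1 | attachable s v]]
  else [:: [::]].

Lemma nc_forestsS m : nc_forests m.+1 =
  [seq rcons s v | s <- nc_forests m, v <- [seq v <- iota 0 m.+1 | attachable s v]].
Proof. by []. Qed.

Definition children (s : seq nat) (k : nat) : nat :=
  count (fun j => (j != k) && (nth 0%N s j == k)) (iota 0 (size s)).

Definition forest_weight (K : pzRingType) (tau : nat -> K) (s : seq nat) : K :=
  \prod_(k < size s) tau (children s k).

Lemma attachableP s v :
  reflect ((v <= size s)%N /\
           forall p, (p < size s)%N -> (v <= nth 0%N s p)%N \/ (p <= v)%N)
          (attachable s v).
Proof.
apply: (iffP andP) => -[vs H]; split=> //.
  by move=> p ps; apply/orP/(allP H); rewrite mem_iota.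
by apply/allP => p; rewrite mem_iota add0n => /= /H/orP.
Qed.

(** The inequality on [p < q] says that the edge ending at [q] does not start
    strictly between the ends of the edge ending at [p]. *)
Definition nc_forest (n : nat) (s : seq nat) : Prop :=
  [/\ size s = n, forall j, (j < n)%N -> (nth 0%N s j <= j)%N &
      forall p q, (p < q)%N -> (q < n)%N ->
        (nth 0%N s q <= nth 0%N s p)%N \/ (p <= nth 0%N s q)%N].

Lemma nc_forestsP n s : reflect (nc_forest n s) (s \in nc_forests n).
Proof.
apply: (iffP idP).
  elim: n s => [s|n IH s]; first by rewrite inE => /eqP ->.
  rewrite nc_forestsS.
  case/allpairsPdep => u [v [/IH[sz le_u nc_u]]].
  rewrite mem_filter => /andP[/attachableP[]]; rewrite sz => vn att _ ->.
  split; first by rewrite size_rcons sz.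
    move=> j jn; rewrite nth_rcons sz; case: (ltngtP j n) => [jn'|jn'|-> //].
      exact: le_u.
    by move: jn; rewrite ltnS leqNgt jn'.
  move=> p q pq qn; rewrite !nth_rcons sz.
  have -> : (p < n)%N by lia.
  case: (ltngtP q n) => [qn'|qn'|_].
  - exact: nc_u.
  - by move: qn; rewrite ltnS leqNgt qn'.
  - by apply: att; lia.
elim: n s => [s [/size0nil -> _ _]|n IH s]; first by rewrite inE.
case/lastP: s => [|s v]; first by move=> [sz].
 
rewrite /nc_forest size_rcons => -[[sz]] le_s nc_s.
have nthE j : (j < n)%N -> nth 0%N (rcons s v) j = nth 0%N s j.
  by move=> jn; rewrite nth_rcons sz jn.
have nthn : nth 0%N (rcons s v) n = v by rewrite nth_rcons sz ltnn eqxx.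
rewrite nc_forestsS; apply: allpairs_f_dep.
  apply: IH; split=> // [j jn|p q pq qn]; first by rewrite -nthE // le_s; lia.
  rewrite -(nthE q) // -(nthE p) ?(ltn_trans pq) //.
  by apply: nc_s => //; exact: ltnW.
have vn : (v <= n)%N by rewrite -nthn le_s.
rewrite mem_filter mem_iota add0n /= ltnS vn andbT.
apply/attachableP; rewrite sz; split=> // p pn.
by rewrite -nthE // -{1 3}nthn; apply: nc_s.
Qed.

Lemma nc_forests_uniq n : uniq (nc_forests n).
Proof.
elim: n => // n IH; rewrite nc_forestsS; apply: allpairs_uniq_dep => //.
  by move=> s _; rewrite filter_uniq // iota_uniq.
by move=> [s v] [s' v'] _ _ /= /rcons_inj [-> ->].
Qed.

Lemma children_rcons s v k :
  children (rcons s v) k = (children s k + ((size s != k) && (v == k)))%N.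
Proof.
rewrite /children size_rcons -addn1 iotaD count_cat add0n /= addn0.
rewrite nth_rcons ltnn eqxx; congr (_ + _)%N; apply: eq_in_count => j.
by rewrite mem_iota add0n nth_rcons => /= ->.
Qed.

Lemma children_size n s : nc_forest n s -> children s n = 0%N.
Proof.
move=> [sz le_s _]; rewrite /children sz; apply/eqP; rewrite -leqn0 leqNgt -has_count.
apply/hasPn => j; rewrite mem_iota add0n => /= jn.
by have := le_s _ jn => ?; rewrite negb_and; apply/orP; right; lia.
Qed.

Lemma attachable_rcons s v k : (k <= size s)%N ->
  attachable (rcons s v) k = attachable s k && ((k <= v)%N || (k == size s)).
Proof.
move=> ks; rewrite /attachable size_rcons ks leqW // andTb.
rewrite -[X in iota _ X]addn1 iotaD all_cat add0n /= nth_rcons ltnn eqxx andbT.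
rewrite [(size s <= k)%N]leq_eqVlt (ltnNge (size s)) ks orbF (eq_sym (size s)).
congr (_ && _).
by apply: eq_in_all => j; rewrite mem_iota add0n nth_rcons => /= ->.
Qed.

Lemma attachable_size s : attachable s (size s).
Proof. by apply/attachableP; split=> // p ps; right; exact: ltnW. Qed.

Section ForestTelescope.
Variables (K : comNzRingType).

(** Walking through the index set, the factors [a] are exchanged for [b] one at
    a time from the right. *)
Lemma prod_diff_telescope n (a b : nat -> K) :
  \sum_(d < n) \prod_(k < n)
     (if (k < d)%N then a k else if k == d :> nat then a k - b k else b k) =
  \prod_(k < n) a k - \prod_(k < n) b k.
Proof.
elim: n => [|n IH]; first by rewrite !big_ord0 subrr.
rewrite !big_ord_recr /= ltnn eqxx.
under eq_bigr => d _.
  rewrite big_ord_recr /= ltnNge (ltnW (ltn_ord d)) /=.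
  rewrite gtn_eqF ?ltn_ord //; over.
rewrite -mulr_suml IH.
have -> : \prod_(k < n) (if (k < n)%N then a k else
    if k == n :> nat then a k - b k else b k) = \prod_(k < n) a k.
  by apply: eq_bigr => k _; rewrite ltn_ord.
ring.
Qed.

Variables (tau T : nat -> K) (w chi : K).
Hypothesis T_rec : forall c, T c = tau c + w * T c.+1.
Hypothesis chi_eq : chi * (1 + w) * T 0%N = w.

(** For power series, the sum of
    [forest_weight tau s' * chi ^+ (size s' - size s)] over all forests [s']
    that extend [s], in closed form: a vertex that can still
    receive children contributes [T] at its number of children instead of
    [tau]. *)
Definition forest_gf (s : seq nat) : K :=
  (1 + w) * \prod_(k < size s)
    (if attachable s k then T (children s k) else tau (children s k)).

(** A forest is either left as it is or extended by one more vertex [v].  Making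
    [v] a child of [d] closes all attachable vertices above [d] and raises the
    number of children of [d]; as [w * T c.+1 = T c - tau c], the sum over [d]
    telescopes. *)
Lemma forest_gf_step n s : s \in nc_forests n ->
  forest_gf s = forest_weight tau s +
    chi * \sum_(v <- [seq v <- iota 0 n.+1 | attachable s v]) forest_gf (rcons s v).
Proof.
move=> /nc_forestsP fs; have sz : size s = n by case: fs.
pose b k := tau (children s k).
pose a k := if attachable s k then T (children s k) else b k.
have gf_rcons v : attachable s v -> chi * forest_gf (rcons s v) =
    w * \prod_(k < n) (if (k < v)%N then a k else if k == v :> nat
                       then T (children s k).+1 else b k).
  move=> sv; rewrite /forest_gf size_rcons sz big_ord_recr /=.
  have -> : attachable (rcons s v) n.
    by rewrite attachable_rcons sz // eqxx orbT -{1}sz attachable_size.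
  have -> : children (rcons s v) n = 0%N.
    by rewrite children_rcons sz eqxx (children_size fs).
  rewrite -[X in _ = X * _]chi_eq.
  rewrite -!mulrA; congr (_ * (_ * _)); rewrite mulrC; congr (_ * _).
  apply: eq_bigr => k _; have kn := ltn_ord k.
  rewrite attachable_rcons ?sz ?(ltnW kn) // children_rcons sz.
  rewrite (gtn_eqF kn) (ltn_eqF kn) orbF /= eq_sym.
  case: (ltngtP k v) => [kv|kv|kv] /=; rewrite ?andbT ?andbF ?addn0 ?addn1 //.
  by rewrite kv sv.
have -> : forest_gf s = (1 + w) * \prod_(k < n) a k by rewrite /forest_gf sz.
have -> : forest_weight tau s = \prod_(k < n) b k by rewrite /forest_weight sz.
rewrite big_filter mulr_sumr.
rewrite -[iota 0 n.+1]/(index_iota 0 n.+1) big_mkord.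
rewrite [\sum_(_ < _ | _) _]big_mkcond big_ord_recr /=.
have att_n : attachable s n by rewrite -sz attachable_size.
rewrite att_n gf_rcons //.
have -> : \prod_(k < n) (if (k < n)%N then a k else if k == n :> nat
    then T (children s k).+1 else b k) = \prod_(k < n) a k.
  by apply: eq_bigr => k _; rewrite ltn_ord.
have -> : \sum_(i < n) (if attachable s i then chi * forest_gf (rcons s i) else 0) =
    \prod_(k < n) a k - \prod_(k < n) b k.
  rewrite -prod_diff_telescope; apply: eq_bigr => d _.
  rewrite [RHS](bigD1 d) //= ltnn eqxx.
  case: ifP => sd; last by rewrite /a sd subrr mul0r.
  rewrite gf_rcons // (bigD1 d) //= ltnn eqxx mulrA; congr (_ * _).
    by rewrite /a sd [in RHS]T_rec /b addrAC subrr add0r.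
  by apply: eq_bigr => k /negPf kd; rewrite -val_eqE /= in kd; rewrite kd.
ring.
Qed.

(** The remainder has order at least [m] in [chi], so [1 + w] is the full forest
    series when [chi] is a power series without constant term. *)
Lemma forest_series m :
  1 + w = \sum_(n < m) (\sum_(s <- nc_forests n) forest_weight tau s) * chi ^+ n
          + chi ^+ m * \sum_(s <- nc_forests m) forest_gf s.
Proof.
elim: m => [|m IH].
  by rewrite big_ord0 add0r mul1r big_seq1 /forest_gf big_ord0 mulr1.
rewrite big_ord_recr /= {}IH -addrA; congr (_ + _).
rewrite -/(nc_forests m.+1) nc_forestsS big_allpairs_dep [in LHS]big_seq.
under eq_bigr => s /forest_gf_step -> do [].
rewrite -big_seq big_split -mulr_sumr mulrDr exprSr; ring.
Qed.

End ForestTelescope.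

(** * Non-crossing linked partitions as forests *)

Section LinkedPartitionForest.
Variable n : nat.
Implicit Types (B : {set 'I_n}) (pi : {set {set 'I_n}}) (s : seq nat).

Definition star s (k : 'I_n) : {set 'I_n} :=
  [set j : 'I_n | (j == k) || (nth 0%N s j == k)].

(** The stars of the non-root leaves are left out: such a vertex only belongs
    to the star of its parent, while the star of an isolated root is a
    singleton block. *)
Definition opens s (k : 'I_n) : bool :=
  (nth 0%N s k == k) || [exists j : 'I_n, (j != k) && (nth 0%N s j == k)].

Definition forest_partition s : {set {set 'I_n}} := star s @: [set k | opens s k].

Definition parent_in pi (k j : 'I_n) : bool :=
  [exists B in pi, [&& is_min k B, j \in B & j != k]].

Definition parent pi (j : 'I_n) : 'I_n := odflt j [pick k | parent_in pi k j].

Definition forest_code pi : seq nat := [seq val (parent pi j) | j <- enum 'I_n].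

Lemma is_minP (j : 'I_n) B :
  reflect (j \in B /\ forall i, i \in B -> (j <= i)%N) (is_min j B).
Proof.
apply: (iffP andP) => -[jB].
  by move/forall_inP.
by move=> H; split=> //; apply/forall_inP.
Qed.

Lemma is_min_uniq (j k : 'I_n) B : is_min j B -> is_min k B -> j = k.
Proof.
move=> /is_minP[jB Hj] /is_minP[kB Hk]; apply/val_inj/eqP.
by rewrite eqn_leq Hj // Hk.
Qed.

Lemma ex_is_min B : B != set0 -> exists k, is_min k B.
Proof.
case/set0Pn => i iB; exists [arg min_(j < i in B) val j]%N.
by case: arg_minnP => // k kB H; apply/is_minP.
Qed.

Lemma nth_forest_code pi (j : 'I_n) : nth 0%N (forest_code pi) j = parent pi j.
Proof. by rewrite (nth_map j) ?size_enum_ord // nth_ord_enum. Qed.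

Section OfPartition.
Variable pi : {set {set 'I_n}}.
Hypothesis pi_NCL : pi \in NCL n.

Lemma NCL_min B : B \in pi -> exists k, is_min k B.
Proof.
move=> piB; apply: ex_is_min; apply: contraTneq piB => ->.
by move: pi_NCL; rewrite inE => /and4P[].
Qed.

Lemma NCL_cover j : exists2 B, B \in pi & j \in B.
Proof.
have : j \in cover pi.
  by move: pi_NCL; rewrite inE => /and4P[_ /eqP -> _ _]; rewrite inE.
by case/bigcupP => B; exists B.
Qed.

Lemma NCL_common B B' j : B \in pi -> B' \in pi -> B != B' ->
  j \in B -> j \in B' ->
  [/\ (2 <= #|B|)%N, (2 <= #|B'|)%N & is_min j B (+) is_min j B'].
Proof.
move=> piB piB' neB jB jB'.
move: pi_NCL; rewrite inE => /and4P[_ _ _ /forall_inP/(_ B piB)].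
move=> /forall_inP/(_ B' piB')/implyP/(_ neB) /orP[/eqP BB0|].
  by have := in_set0 j; rewrite -BB0 inE jB jB'.
case/existsP => k /and4P[/eqP BB B2 B2' mk].
have : j \in B :&: B' by rewrite inE jB.
by rewrite BB inE => /eqP ->.
Qed.

(** A common element of two distinct blocks is the minimum of exactly one of
    them.  Hence a vertex opens at most one block, and it is a non-minimal
    element of at most one block: its parent is the minimum of the latter. *)
Lemma NCL_min_uniq B B' k : B \in pi -> B' \in pi ->
  is_min k B -> is_min k B' -> B = B'.
Proof.
move=> piB piB' kB kB'; apply/eqP; apply: contraT => neB.
case: (NCL_common piB piB' neB (j := k)) => [||_ _]; rewrite ?kB ?kB' //.
  by case/is_minP: kB.
by case/is_minP: kB'.
Qed.

Lemma NCL_nonmin_uniq B B' j : B \in pi -> B' \in pi ->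
  j \in B -> j \in B' -> ~~ is_min j B -> ~~ is_min j B' -> B = B'.
Proof.
move=> piB piB' jB jB' mB mB'; apply/eqP; apply: contraT => neB.
by case: (NCL_common piB piB' neB jB jB'); rewrite (negPf mB) (negPf mB').
Qed.

Lemma parent_inP k j :
  reflect (exists B, [/\ B \in pi, is_min k B, j \in B & j != k])
          (parent_in pi k j).
Proof.
apply: (iffP exists_inP) => [[B piB /and3P[]]|[B [piB kB jB jk]]].
  by exists B.
by exists B => //; apply/and3P.
Qed.

Lemma parent_in_uniq k l j : parent_in pi k j -> parent_in pi l j -> k = l.
Proof.
have nonmin B i : is_min i B -> j != i -> ~~ is_min j B.
  by move=> iB; apply: contraNN => /is_min_uniq/(_ iB) ->.
move=> /parent_inP[B [piB kB jB jk]] /parent_inP[B' [piB' lB' jB' jl]].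
have eB :=
  NCL_nonmin_uniq piB piB' jB jB' (nonmin _ _ kB jk) (nonmin _ _ lB' jl).
by apply: is_min_uniq kB _; rewrite eB.
Qed.

Lemma parentP j :
  (parent pi j = j /\ forall k, ~~ parent_in pi k j) \/
  (parent_in pi (parent pi j) j /\ (parent pi j < j)%N).
Proof.
rewrite /parent; case: pickP => [k kj|none] /=; last first.
  by left; split=> // k; rewrite none.
right; split=> //; case/parent_inP: kj => B [_ /is_minP[_ /(_ j)] H jB jk].
by rewrite ltn_neqAle eq_sym jk H.
Qed.

Lemma parent_of_in k j : parent_in pi k j -> parent pi j = k.
Proof.
move=> kj; case: (parentP j) => -[pj H]; last exact: parent_in_uniq pj kj.
by move/(_ k): H; rewrite kj.
Qed.

Lemma parent_neq k j : parent pi j = k -> j != k -> parent_in pi k j.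
Proof. by case: (parentP j) => -[pj _] jk; rewrite -jk // pj eqxx. Qed.

Lemma star_forest_code B k : B \in pi -> is_min k B ->
  star (forest_code pi) k = B.
Proof.
move=> piB kB; apply/setP => j; rewrite inE nth_forest_code.
have [->|jk] := eqVneq j k; first by case/is_minP: kB.
apply/eqP/idP => /= [/val_inj /parent_neq /(_ jk)|jB].
  by case/parent_inP => B' [piB' kB' jB' _]; rewrite (NCL_min_uniq piB piB' kB kB').
by rewrite (@parent_of_in k) //; apply/parent_inP; exists B.
Qed.

(** The blocks are recovered as the stars of their minima.  A vertex that opens
    a block and has a parent lies in two blocks, so its own block has a second
    element, which is a child of it: its star is not left out. *)
Lemma forest_codeK : forest_partition (forest_code pi) = pi.
Proof.
apply/setP => B; apply/imsetP/idP => [[k]|piB].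
  rewrite inE /opens nth_forest_code => /orP[/eqP/val_inj pk|/existsP[j jk]] ->.
    have [B' piB' kB'] := NCL_cover k; have [l lB'] := NCL_min piB'.
    have kl : k = l.
      apply/eqP; apply: contraT => kl; have : parent_in pi l k.
        by apply/parent_inP; exists B'.
      by move/parent_of_in; rewrite pk => /eqP; rewrite (negPf kl).
    by rewrite (star_forest_code piB') // kl.
  move: jk; rewrite nth_forest_code => /andP[jk /eqP/val_inj/parent_neq/(_ jk)].
  by case/parent_inP => B' [piB' kB' _ _]; rewrite (star_forest_code piB').
have [k kB] := NCL_min piB; exists k; last by rewrite (star_forest_code piB).
rewrite inE /opens nth_forest_code.
case: (parentP k) => -[pk H]; first by rewrite pk eqxx.
case/parent_inP: pk => B' [piB' pB' kB' kp].
have neB : B != B'.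
  by apply: contraNneq kp => eB; apply/eqP/(is_min_uniq kB); rewrite eB.
case: (NCL_common piB piB' neB (j := k)) => // [|B2 _ _]; first by case/is_minP: kB.
apply/orP; right; move: B2; rewrite (cardD1 k); case/is_minP: (kB) => -> _.
rewrite ltnS => /card_gt0P[j]; rewrite !inE => /andP[jk jB].
apply/existsP; exists j; rewrite jk nth_forest_code (@parent_of_in k) ?eqxx //.
by apply/parent_inP; exists B.
Qed.

(** If the edge ending at [q] started strictly inside the edge ending at [p < q],
    these two edges would make their blocks cross. *)
Lemma nc_forest_code : nc_forest n (forest_code pi).
Proof.
split; first by rewrite size_map size_enum_ord.
  move=> j jn; rewrite (nth_forest_code pi (Ordinal jn)).
  by case: (parentP (Ordinal jn)) => [[-> //]|[_ /ltnW]].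
move=> p q pq qn; have pn := ltn_trans pq qn.
rewrite (nth_forest_code pi (Ordinal pn)) (nth_forest_code pi (Ordinal qn)).
set p' := Ordinal pn; set q' := Ordinal qn.
case: (leqP (parent pi q') (parent pi p')) => [|lpq]; first by left.
case: (leqP p (parent pi q')) => [|lqp]; first by right.
exfalso; case: (parentP p') => [[pp _]|[pp _]].
  by move: lpq; rewrite pp /=; lia.
case: (parentP q') => [[qq _]|[qq _]].
  by move: lqp; rewrite qq /=; lia.
case/parent_inP: pp => B [piB mB pB _]; case/parent_inP: qq => B' [piB' mB' qB' _].
have neB : B != B'.
  apply/eqP => eB; move: mB; rewrite eB => /is_min_uniq/(_ mB') eq.
  by rewrite eq ltnn in lpq.
move: pi_NCL; rewrite inE => /and4P[_ _ /forall_inP/(_ B piB) + _].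
move=> /forall_inP/(_ B' piB')/implyP/(_ neB)/negP[].
apply/exists_inP; exists (parent pi p'); first by case/is_minP: mB.
apply/exists_inP; exists (parent pi q'); first by case/is_minP: mB'.
apply/exists_inP; exists p' => //.
by apply/exists_inP; exists q' => //; rewrite lpq lqp pq.
Qed.

End OfPartition.

Section OfForest.
Variable s : seq nat.
Hypothesis s_nc : nc_forest n s.

Let f_le (j : 'I_n) : (nth 0%N s j <= j)%N. Proof. by case: s_nc => _ + _; apply. Qed.

Lemma is_min_star k : is_min k (star s k).
Proof.
apply/is_minP; rewrite inE eqxx; split=> // i; rewrite inE => /orP[/eqP -> //|/eqP <-].
exact: f_le.
Qed.

Lemma star_inj : injective (star s).
Proof.
by move=> k l e; apply: is_min_uniq (is_min_star k) _; rewrite e is_min_star.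
Qed.

Lemma star_lt k j : j \in star s k -> (k < j)%N -> nth 0%N s j = k.
Proof. by rewrite inE => /orP[/eqP -> |/eqP //]; rewrite ltnn. Qed.

Lemma star_ge k j : j \in star s k -> (k <= j)%N.
Proof. by have /is_minP[_] := is_min_star k; apply. Qed.

Lemma card_star k : #|star s k| = (children s k).+1.
Proof.
have -> : star s k = k |: [set j : 'I_n | (j != k) && (nth 0%N s j == k)].
  by apply/setP => j; rewrite !inE; case: eqP.
rewrite cardsU1 !inE eqxx /= add1n; congr _.+1.
have sz : size s = n by case: s_nc.
rewrite /children sz -val_enum_ord count_map -sum1_count big_enum_cond -sum1_card.
by apply: eq_bigl => j; rewrite !inE.
Qed.

Lemma opensN_children k : ~~ opens s k -> children s k = 0%N.
Proof.
rewrite negb_or => /andP[_ /existsPn H]; apply/eqP.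
rewrite -eqSS -card_star; apply/eqP.
rewrite -(cards1 k); apply: eq_card => j; rewrite !inE.
by case: eqVneq => //= jk; have := H j; rewrite jk => /negPf.
Qed.

Lemma linkedC B B' : linked B B' = linked B' B.
Proof.
rewrite /linked setIC; congr (_ || _); apply: eq_existsb => j.
by congr (_ && _); rewrite andbCA addbC.
Qed.

(** Two stars can only meet in the larger centre, as a child of the smaller
    one; that centre opens a star although it is not a root, so it has a child
    of its own. *)
Lemma linked_star (k l : 'I_n) : opens s l -> (k < l)%N ->
  linked (star s k) (star s l).
Proof.
move=> ol kl.
have common j : j \in star s k -> j \in star s l -> j = l.
  move=> jk jl; have lj := star_ge jl; apply/val_inj/eqP.
  rewrite eqn_leq lj andbT leqNgt; apply/negP => lj'.
  by have := star_lt jl lj'; rewrite (star_lt jk (ltn_trans kl lj')); lia.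
have [lk|lk] := boolP (l \in star s k); last first.
  apply/orP; left; apply/eqP/setP => j; rewrite in_setI in_set0.
  apply/negP => /andP[jk jl].
  by move: lk; rewrite -(common j) // jk.
apply/orP; right; apply/existsP; exists l.
have fl := star_lt lk kl.
have cardP (i j : 'I_n) : i \in star s j -> (j < i)%N -> (2 <= #|star s j|)%N.
  move=> ij ji; rewrite (cardD1 j) inE eqxx ltnS; apply/card_gt0P; exists i.
  by rewrite inE ij andbT; apply: contraTneq ji => ->; rewrite ltnn.
apply/and4P; split.
- apply/eqP/setP => j; rewrite in_setI in_set1; apply/andP/eqP => [[]|->].
    exact: common.
  by split=> //; rewrite inE eqxx.
- exact: cardP lk kl.
- case/orP: ol => [|/existsP[j /andP[jl /eqP fj]]]; first by rewrite fl; lia.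
  apply: (@cardP j); first by rewrite inE fj eqxx orbT.
  by rewrite ltn_neqAle eq_sym (jl : j != l :> nat) -fj f_le.
- rewrite is_min_star addbT; apply/negP => /is_min_uniq/(_ (is_min_star k)) E.
  by rewrite E ltnn in kl.
Qed.

(** A crossing of two stars contains a crossing of two edges, whichever centre
    comes first. *)
Lemma crossing_star (k l : 'I_n) : k != l -> ~~ crossing (star s k) (star s l).
Proof.
move=> kl; apply/negP => /exists_inP[i ik] /exists_inP[m ml] /exists_inP[p pk].
move=> /exists_inP[q ql /and3P[im mp pq]].
have [? ?] := (star_ge ik, star_ge ml).
have nc (x y : 'I_n) : (x < y)%N ->
    (nth 0%N s y <= nth 0%N s x)%N \/ (x <= nth 0%N s y)%N.
  by move=> xy; case: s_nc => _ _; apply.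
have fp : nth 0%N s p = k by apply: star_lt => //; lia.
have fq : nth 0%N s q = l by apply: star_lt => //; lia.
have klv : k <> l :> nat by move=> /val_inj/eqP; rewrite (negPf kl).
have := nc _ _ pq; rewrite fp fq => H.
have fm : nth 0%N s m = l by apply: star_lt => //; lia.
have := nc _ _ mp; rewrite fp fm; lia.
Qed.

Lemma forest_partition_NCL : forest_partition s \in NCL n.
Proof.
rewrite inE; apply/and4P; split.
- apply/imsetP => -[k _ e0]; have := is_min_star k.
  by rewrite -e0 /is_min inE.
- apply/eqP/setP => j; rewrite inE; apply/bigcupP.
  have [fj|fj] := eqVneq (nth 0%N s j) j.
    exists (star s j); last by rewrite inE eqxx.
    by apply: imset_f; rewrite inE /opens fj eqxx.
  have fn : (nth 0%N s j < n)%N by apply: leq_ltn_trans (f_le j) _.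
  exists (star s (Ordinal fn)); last by rewrite inE eqxx orbT.
  apply: imset_f; rewrite inE; apply/orP; right; apply/existsP; exists j.
  by rewrite eqxx andbT -val_eqE /= eq_sym.
- apply/forall_inP => _ /imsetP[k _ ->]; apply/forall_inP => _ /imsetP[l _ ->].
  apply/implyP => kl; apply: crossing_star.
  by apply: contraNneq kl => ->.
apply/forall_inP => _ /imsetP[k + ->]; rewrite inE => ok.
apply/forall_inP => _ /imsetP[l + ->]; rewrite inE => ol.
apply/implyP => kl; case: (ltngtP k l) => [lt|lt|/val_inj e].
- exact: linked_star.
- by rewrite linkedC; exact: linked_star.
- by rewrite e eqxx in kl.
Qed.

Lemma parent_in_forest k j :
  parent_in (forest_partition s) k j = (j != k) && (nth 0%N s j == k).
Proof.
apply/exists_inP/andP => [[_ /imsetP[l _ ->]] /and3P[mk]|[jk fj]].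
  by rewrite (is_min_uniq mk (is_min_star l)) inE; case: eqP.
exists (star s k); last by rewrite is_min_star inE fj orbT jk.
by apply: imset_f; rewrite inE; apply/orP; right; apply/existsP; exists j; rewrite jk.
Qed.

Lemma forest_partitionK : forest_code (forest_partition s) = s.
Proof.
have sz : size s = n by case: s_nc.
apply: (@eq_from_nth _ 0%N); first by rewrite size_map size_enum_ord sz.
move=> j; rewrite size_map size_enum_ord => jn; set j' := Ordinal jn.
rewrite -[j]/(val j') nth_forest_code /parent.
case: pickP => [k|none] /=; first by rewrite parent_in_forest => /andP[_ /eqP].
have fn : (nth 0%N s j < n)%N by apply: leq_ltn_trans (f_le j') _.
have := none (Ordinal fn); rewrite parent_in_forest /= eqxx andbT.
by move/negbFE/eqP/(congr1 val).
Qed.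

Lemma non_minima_forest : non_minima (forest_partition s) = [set k | ~~ opens s k].
Proof.
apply/setP => k; rewrite !inE; congr (~~ _); apply/exists_inP/idP => [[B]|ok].
  case/imsetP => l + ->; rewrite inE => ol.
  by move/is_min_uniq/(_ (is_min_star l)) => ->.
by exists (star s k); [apply: imset_f; rewrite inE | exact: is_min_star].
Qed.

End OfForest.

Lemma forest_code_perm :
  perm_eq [seq forest_code pi | pi <- enum (NCL n)] (nc_forests n).
Proof.
apply: uniq_perm.
- rewrite map_inj_in_uniq ?enum_uniq // => pi pi'.
  rewrite !mem_enum => h h' e.
  by rewrite -(forest_codeK h) e forest_codeK.
- exact: nc_forests_uniq.
move=> s; apply/mapP/nc_forestsP => [[pi]|s_nc].
  by rewrite mem_enum => h ->; exact: nc_forest_code.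
exists (forest_partition s); last by rewrite forest_partitionK.
by rewrite mem_enum forest_partition_NCL.
Qed.

End LinkedPartitionForest.

Section MomentForests.
Variables (R : realType) (A : algType R[i]).

Lemma t_block_const (t : A -> seq A -> R[i]) n (x : A) (B : {set 'I_n}) m :
  #|B| = m.+1 -> t_block t (fun=> x) B = t x (nseq m x).
Proof.
rewrite cardE /t_block; case: (enum B) => //= i r [<-].
by congr (t x _); elim: r => //= _ r ->.
Qed.

(** A vertex that opens no star contributes the factor [t_0] through
    [non_minima], which is the weight of a vertex without children. *)
Lemma t_term_forest (t : A -> seq A -> R[i]) n (x : A) s : nc_forest n s ->
  t_term t (fun=> x) (forest_partition n s) = forest_weight (T_transform t x) s.
Proof.
move=> s_nc; rewrite /t_term (non_minima_forest s_nc) big_imset; last first.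
  by move=> k l _ _; exact: star_inj.
rewrite /forest_weight; have -> : size s = n by case: s_nc.
rewrite [RHS](bigID (opens s)) /=; congr (_ * _).
  by apply: eq_big => k; rewrite ?inE // => _; apply/t_block_const/card_star.
apply: eq_big => k; rewrite ?inE // => ok.
by rewrite (opensN_children s_nc).
Qed.

(** For equal arguments the recurrence is a sum over forests, each vertex
    weighted by its number of children. *)
Lemma moment_forests (phi : {scalar A}) (t : A -> seq A -> R[i]) (x : A) n :
  phi 1 = 1 -> t_coefficients phi t -> phi x != 0 ->
  phi (x ^+ n) = \sum_(s <- nc_forests n) forest_weight (T_transform t x) s.
Proof.
move=> phi1 ht x0; case: n => [|n].
  by rewrite expr0 phi1 big_seq1 /forest_weight big_ord0.
have -> : x ^+ n.+1 = \prod_(i < n.+1) x by rewrite prodr_const card_ord.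
rewrite (ht _ (fun=> x)) // -(perm_big _ (forest_code_perm n.+1)) big_map /=.
rewrite big_enum_cond /=; apply: eq_big => [pi|pi h]; first by rewrite andbT.
by rewrite -(@t_term_forest _ n.+1) ?forest_codeK //; exact: nc_forest_code.
Qed.

End MomentForests.

(** * Moment series *)

Section Composition.
Variable C : fieldType.
Implicit Types (m tau : nat -> C) (f u v : pseries C).

(** The composite series [\sum_k m k * u ^+ k] for [u] without constant term. *)
Definition ps_comp m u : pseries C := fun n => \sum_(k < n.+1) m k * (u ^+ k) n.

Lemma ps_constM (a b : C) : ps_const (a * b) = ps_const a * ps_const b.
Proof.
apply/funext => -[|n]; first by rewrite mulsE0.
by rewrite mulsE big1 // => -[[|i] _] _ /=; rewrite ?mul0r ?mulr0.
Qed.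

Lemma ps_const_mulE (a : C) f n : (ps_const a * f) n = a * f n.
Proof.
rewrite mulsE big_ord_recl /= subn0 big1 ?addr0 // => i _.
by rewrite mul0r.
Qed.

Lemma ps_const_weight tau s :
  forest_weight (fun c => ps_const (tau c)) s = ps_const (forest_weight tau s).
Proof.
rewrite /forest_weight; elim/big_rec2: _ => // i x y _ ->.
by rewrite ps_constM.
Qed.

Lemma ps_const_sum (I : Type) (r : seq I) (F : I -> C) :
  \sum_(i <- r) ps_const (F i) = ps_const (\sum_(i <- r) F i).
Proof.
elim/big_rec2: _ => [|i x y _ ->]; first by apply/funext => -[].
by apply/funext => -[|n]; rewrite addsE //= addr0.
Qed.

(** The generating series [M] of the forest sums satisfies
    [M = 1 + z * M * T(M - 1)], where [T] has the coefficients [tau]; this is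
    that equation solved for [z], with [M = 1 + w]. *)
Lemma forest_comp (tau chi : pseries C) :
  chi 0%N = 0 -> chi * (1 + psX) * tau = psX ->
  ps_comp (fun n => \sum_(s <- nc_forests n) forest_weight tau s) chi = 1 + psX.
Proof.
move=> chi0 chiE; apply/funext => n; pose T c : pseries C := fun i => tau (c + i)%N.
have T_rec c : T c = ps_const (tau c) + psX * T c.+1.
  apply/funext => -[|i]; rewrite addsE psX_mulE /T ?addn0 ?addr0 //=.
  by rewrite add0r addSnnS.
have := @forest_series _ (fun c => ps_const (tau c)) T psX chi T_rec chiE n.+1.
move=> /(congr1 (@^~ n)) ->; rewrite addsE sumsE [X in _ + X]mulsE.
rewrite [X in _ + X]big1 ?addr0 => [|i _]; last by rewrite exps_order ?mul0r.
apply: eq_bigr => k _; rewrite -ps_const_mulE -ps_const_sum.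
by under [in RHS]eq_bigr do rewrite ps_const_weight.
Qed.

(** Without constant terms, the coefficient of index [n] of a power with exponent
    at least [2] only involves coefficients of smaller index. *)
Lemma eq_exps u v n k : u 0%N = 0 -> v 0%N = 0 ->
  (forall i, (i < n)%N -> u i = v i) -> (u ^+ k.+2) n = (v ^+ k.+2) n.
Proof.
move=> u0 v0 uv; have E i : (i < n)%N -> (u ^+ k.+1) i = (v ^+ k.+1) i.
  elim: (k.+1) i => // j IH i i_n; rewrite !exprS; apply: eq_muls => l l_i.
    by apply: uv; lia.
  by apply: IH; lia.
rewrite !(exprS _ k.+1) !mulsE; apply: eq_bigr => -[[|i] /= i_n] _.
  by rewrite u0 v0 !mul0r.
have [e|lt] := eqVneq i.+1 n.
  by rewrite -e subnn !exps_order ?mulr0.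
by rewrite uv ?E //; lia.
Qed.

Lemma ps_comp_inj m u v : m 1%N != 0 -> u 0%N = 0 -> v 0%N = 0 ->
  ps_comp m u = ps_comp m v -> u = v.
Proof.
move=> m1 u0 v0 uv; apply/funext; elim/ltn_ind => -[_|n IH]; first by rewrite u0 v0.
have := congr1 (@^~ n.+1) uv; rewrite /ps_comp !big_ord_recl /=.
move=> /addrI; rewrite (eq_bigr (fun i : 'I_n => m (bump 0 (bump 0 i)) *
   (v ^+ bump 0 (bump 0 i)) n.+1)) => [|i _]; last first.
  by congr (_ * _); apply: eq_exps.
by move=> /addIr /(mulfI m1).
Qed.

End Composition.

(** * Products of resolvents *)

Section Resolvents.
Variables (K : comNzRingType) (A : algType K).

Lemma left_inverse_resolvent (w k : K) (x a : A) :
  a * (1 - (w * k) *: x) = 1 -> a = 1 + w *: (k *: (a * x)).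
Proof. by rewrite mulrBr mulr1 -scalerAr scalerA => <-; rewrite subrK. Qed.

Lemma right_inverse_resolvent (w k : K) (x a : A) :
  (1 - (w * k) *: x) * a = 1 -> a = 1 + w *: (k *: (x * a)).
Proof. by rewrite mulrBl mul1r -scalerAl scalerA => <-; rewrite subrK. Qed.

Variables (w k l : K) (x y a b : A).
Hypotheses (aE : a = 1 + w *: (k *: (a * x))) (bE : b = 1 + w *: (l *: (y * b))).

(** For [a = (1 - w k x)^-1] and [b = (1 - w l y)^-1], the scalar in front of
    [x * y] is the one for which the product has no term that is linear in
    [k *: (a * x) - 1] or [l *: (y * b) - 1]. *)
Lemma resolvent_product :
  a * (1 - (w * (1 + w) * k * l) *: (x * y)) * b =
  (1 + w) *: 1 - w *: ((k *: (a * x) - 1) * (l *: (y * b) - 1)).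
Proof.
set p := k *: (a * x); set q := l *: (y * b).
have -> : a * (1 - (w * (1 + w) * k * l) *: (x * y)) * b =
    a * b - (w * (1 + w)) *: (p * q).
  rewrite mulrBr mulr1 mulrBl; congr (_ - _).
  rewrite /p /q -!scalerAr -!scalerAl !scalerA !mulrA; congr (_ *: _).
  ring.
move: aE bE; rewrite -/p -/q; move: (p) (q) => {}p {}q -> ->.
rewrite mulrDl mul1r mulrDr mulr1 -scalerAl -scalerAr mulrDr mulr1.
rewrite mulrBl mul1r mulrBr mulr1 !scalerDl scale1r !scalerBr.
rewrite scalerA [w *: (p * q) + _]addrC addrA addrKA.
by rewrite !opprB [in RHS]addrA [in RHS](addrACA 1 w%:A) subrr addr0 addrA.
Qed.

End Resolvents.

(** * Series with coefficients in free subalgebras *)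

Section Freeness.
Variables (R : realType) (A : algType R[i]) (phi : {scalar A}).
Implicit Types (k chi : pseries R[i]) (f g : pseries A) (e : bool).

Definition ps_phi f : pseries R[i] := fun n => phi (f n).

Lemma ps_phiD f g : ps_phi (f + g) = ps_phi f + ps_phi g.
Proof. by apply/funext => n; rewrite /ps_phi addsE linearD. Qed.

Lemma ps_phiZ k f : ps_phi (k *: f) = k * ps_phi f.
Proof.
apply/funext => n; rewrite /ps_phi scalesE linear_sum mulsE.
by apply: eq_bigr => i _; rewrite linearZ.
Qed.

Lemma ps_phi1 : phi 1 = 1 -> ps_phi 1 = 1.
Proof. by move=> phi1; apply/funext => -[|n]; rewrite /ps_phi //= linear0. Qed.

Lemma exp_ps_const (x : A) n : ps_const x ^+ n = ps_const (x ^+ n).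
Proof.
elim: n => [|n IH]; first by [].
rewrite !exprS IH; apply/funext => -[|i]; first by rewrite mulsE0.
by rewrite mulsE big1 // => -[[|j] _] _ /=; rewrite ?mul0r ?mulr0.
Qed.

Lemma scale_ps_constE k (x : A) n : (k *: ps_const x) n = k n *: x.
Proof.
rewrite scalesE big_ord_recr /= subnn big1 ?add0r // => i _.
case E: (n - i)%N => /=; rewrite ?scaler0 //.
by have := ltn_ord i; lia.
Qed.

Lemma ps_phi_geometric chi (x : A) :
  ps_phi (geometric (chi *: ps_const x)) = ps_comp (fun n => phi (x ^+ n)) chi.
Proof.
apply/funext => n; rewrite /ps_phi /geometric sumsE linear_sum.
apply: eq_bigr => i _; rewrite exprZn exp_ps_const scale_ps_constE linearZ.
by rewrite mulrC.
Qed.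

Definition subalgebra (S : set A) : Prop :=
  [/\ S 1, forall (c : R[i]) x y, S x -> S y -> S (c *: x + y)
        & forall x y, S x -> S y -> S (x * y)].

Lemma generated_subalgebraP star (G : set A) :
  subalgebra (generated_subalgebra star G) /\
  forall x, G x -> generated_subalgebra star G x.
Proof.
split; last by move=> x Gx S [_ /(_ x Gx)].
split.
- by move=> S [[[S1 _ _] _] _]; exact: set_mem S1.
- move=> c x y Sx Sy S HS; have [[[_ Slin _] _] _] := HS.
  by apply: set_mem (Slin c x y _ _); apply: mem_set; [exact: Sx | exact: Sy].
move=> x y Sx Sy S HS; have [[[_ _ Smul] _] _] := HS.
by apply: set_mem (Smul x y _ _); apply: mem_set; [exact: Sx | exact: Sy].
Qed.

Section SeriesIn.
Variable S : set A.
Hypothesis S_alg : subalgebra S.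

Definition series_in f : Prop := forall n, S (f n).

Lemma subalgebra0 : S 0.
Proof.
by case: S_alg => S1 Slin _; have := Slin (-1) 1 1 S1 S1; rewrite scaleN1r addNr.
Qed.

Lemma subalgebraD x y : S x -> S y -> S (x + y).
Proof. by case: S_alg => _ Slin _ Sx Sy; rewrite -[x]scale1r; exact: Slin. Qed.

Lemma subalgebraZ (c : R[i]) x : S x -> S (c *: x).
Proof.
by case: S_alg => _ Slin _ Sx; rewrite -[_ *: _]addr0; apply/Slin/subalgebra0.
Qed.

Lemma subalgebra_sum (I : Type) (r : seq I) (P : pred I) (F : I -> A) :
  (forall i, P i -> S (F i)) -> S (\sum_(i <- r | P i) F i).
Proof.
move=> SF; elim/big_rec: _ => [|i x Pi Sx]; first exact: subalgebra0.
by apply: subalgebraD => //; exact: SF.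
Qed.

Lemma series_in1 : series_in 1.
Proof. by case: S_alg => S1 _ _ [|n]; [exact: S1 | exact: subalgebra0]. Qed.

Lemma series_in_const x : S x -> series_in (ps_const x).
Proof. by move=> Sx [|n]; [exact: Sx | exact: subalgebra0]. Qed.

Lemma series_inM f g : series_in f -> series_in g -> series_in (f * g).
Proof.
case: S_alg => _ _ Smul Sf Sg n; rewrite mulsE; apply: subalgebra_sum => i _.
exact: Smul.
Qed.

Lemma series_inZ k f : series_in f -> series_in (k *: f).
Proof.
by move=> Sf n; rewrite scalesE; apply: subalgebra_sum => i _; exact: subalgebraZ.
Qed.

Lemma series_inB f g : series_in f -> series_in g -> series_in (f - g).
Proof.
move=> Sf Sg n; rewrite subsE; apply: subalgebraD => //.
by rewrite -scaleN1r; exact: subalgebraZ.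
Qed.

Lemma series_in_geometric f : series_in f -> series_in (geometric f).
Proof.
move=> Sf n; rewrite /geometric sumsE; apply: subalgebra_sum => i _.
suff Sfi : series_in (f ^+ i) by exact: Sfi.
elim: (val i) => [|j IH]; first by rewrite expr0; exact: series_in1.
by rewrite exprS; exact: series_inM.
Qed.

End SeriesIn.

(** The linear span of the alternating products of centered elements whose last
    factor lies in [S e]. *)
Inductive alternating (S : bool -> set A) : bool -> A -> Prop :=
| alternating_one e x : S e x -> phi x = 0 -> alternating S e x
| alternating_mul e u x :
    alternating S e u -> S (~~ e) x -> phi x = 0 -> alternating S (~~ e) (u * x)
| alternating0 e : alternating S e 0
| alternating_lin e (c : R[i]) u v :
    alternating S e u -> alternating S e v -> alternating S e (c *: u + v).

Section Alternating.
Variable S : bool -> set A.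

(* The word that starts in class [e] and alternates. *)
Let alt_eps e (i : nat) : bool := e (+) odd i.

(** Allowing any further alternating factors on the right is what makes the
    induction go through. *)
Lemma phi_alternating_mul e u : free_family phi S -> alternating S e u ->
  forall n (a : nat -> A),
    (forall i, (i < n)%N -> S (alt_eps (~~ e) i) (a i) /\ phi (a i) = 0) ->
    phi (u * \prod_(i < n) a i) = 0.
Proof.
move=> hS; have alt e' n (a : nat -> A) :
    (forall i, (i < n.+1)%N -> S (alt_eps e' i) (a i) /\ phi (a i) = 0) ->
    phi (\prod_(i < n.+1) a i) = 0.
  move=> Ha; apply: (hS n.+1 (alt_eps e') a) => // i kn; try by case: (Ha i kn).
  by rewrite /alt_eps /=; case: e' {Ha}; case: (odd i).
have cons e' x n (a : nat -> A) : S e' x -> phi x = 0 ->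
    (forall i, (i < n)%N -> S (alt_eps (~~ e') i) (a i) /\ phi (a i) = 0) ->
    forall i, (i < n.+1)%N -> S (alt_eps e' i) (if i is j.+1 then a j else x) /\
      phi (if i is j.+1 then a j else x) = 0.
  move=> Sx x0 Ha [|i] kn; first by rewrite /alt_eps addbF.
  by have := Ha i kn; rewrite /alt_eps /= addbN addNb.
elim=> {e u} [e x Sx x0|e u x _ IH Sx x0|e|e c u v _ IHu _ IHv] n a Ha.
- have := alt e n _ (cons e x n a Sx x0 Ha); by rewrite big_ord_recl.
- have := IH n.+1 _ (cons _ x n a Sx x0 Ha); by rewrite big_ord_recl mulrA.
- by rewrite mul0r linear0.
by rewrite mulrDl -scalerAl linearP IHu // IHv // mulr0 addr0.
Qed.

Lemma phi_alternating e u : free_family phi S -> alternating S e u -> phi u = 0.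
Proof.
move=> hS /(phi_alternating_mul hS)/(_ 0%N (fun=> 0)); rewrite big_ord0 mulr1.
by apply.
Qed.

Definition alternating_series e f : Prop := forall n, alternating S e (f n).

Definition centered_series e f : Prop := series_in (S e) f /\ ps_phi f = 0.

Lemma alternatingD e u v :
  alternating S e u -> alternating S e v -> alternating S e (u + v).
Proof. by move=> hu hv; rewrite -[u]scale1r; exact: alternating_lin. Qed.

Lemma alternating_sum e (I : Type) (r : seq I) (P : pred I) (F : I -> A) :
  (forall i, P i -> alternating S e (F i)) ->
  alternating S e (\sum_(i <- r | P i) F i).
Proof.
move=> hF; elim/big_rec: _ => [|i x Pi hx]; first exact: alternating0.
by apply: alternatingD => //; exact: hF.
Qed.

Lemma alternating_seriesD e f g : alternating_series e f ->
  alternating_series e g -> alternating_series e (f + g).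
Proof. by move=> hf hg n; exact: alternatingD. Qed.

Lemma alternating_seriesZ e k f :
  alternating_series e f -> alternating_series e (k *: f).
Proof.
move=> hf n; rewrite scalesE; apply: alternating_sum => i _.
by rewrite -[_ *: _]addr0; apply: alternating_lin => //; exact: alternating0.
Qed.

Lemma alternating_series_one e f : centered_series e f -> alternating_series e f.
Proof.
case=> Sf f0 n; apply: alternating_one => //.
exact: (congr1 (@^~ n) f0).
Qed.

Lemma alternating_seriesM e f g : alternating_series e f ->
  centered_series (~~ e) g -> alternating_series (~~ e) (f * g).
Proof.
move=> hf [Sg g0] n; rewrite mulsE; apply: alternating_sum => i _.
apply: alternating_mul => //.
exact: (congr1 (@^~ (n - i)%N) g0).
Qed.

Lemma ps_phi_alternating e f : free_family phi S -> alternating_series e f ->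
  ps_phi f = 0.
Proof. by move=> hS hf; apply/funext => n; exact: phi_alternating (hf n). Qed.

(** Expanding the geometric series, every term apart from [b * a] is a sum of
    alternating products. *)
Lemma ps_phi_sandwich k c d (p q : pseries A) :
  phi 1 = 1 -> free_family phi S -> k 0%N = 0 ->
  centered_series true p -> centered_series false q ->
  ps_phi ((d%:A + c *: q) * geometric (k *: (p * q)) * (d%:A + c *: p)) = d * d.
Proof.
move=> phi1 hS k0 hp hq; set b := d%:A + c *: q; set a := d%:A + c *: p.
set u := k *: (p * q).
have u0 : u 0%N = 0 by rewrite /u scales0 k0 scale0r.
have altM f : alternating_series false f -> alternating_series false (f * u).
  move=> hf; rewrite /u -scalerAr mulrA; apply: alternating_seriesZ.
  apply: (alternating_seriesM (e := true)) hq.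
  exact: (alternating_seriesM (e := false)).
have alt_u : alternating_series false u.
  apply: alternating_seriesZ; apply: (alternating_seriesM (e := true)) hq.
  exact: alternating_series_one.
have alt_bu : alternating_series false (b * u).
  rewrite mulrDl mulr_algl -scalerAl; apply: alternating_seriesD.
    exact: alternating_seriesZ.
  by apply/alternating_seriesZ/altM/alternating_series_one.
have alt_bg : alternating_series false (b * (geometric u - 1)).
  move=> n.
  rewrite (@eq_muls _ _ b _ (\sum_(i < n.+1) u ^+ i - 1) n) //; last first.
    by move=> i i_n; rewrite !subsE (@geometricE _ _ n.+1).
  rewrite big_ord_recl expr0 addrAC subrr add0r mulr_sumr sumsE.
  apply: alternating_sum => i _; rewrite exprS mulrA.
  have : alternating_series false (b * u * u ^+ (val i)).
    elim: (val i) => [|j IH]; first by rewrite mulr1.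
    by rewrite exprSr mulrA; exact: altM.
  exact.
have hba : ps_phi (b * a) = d * d.
  rewrite mulrDl mulr_algl -scalerAl !mulrDr mulr_algr -scalerAr.
  rewrite !scalerDr !scalerA !ps_phiD !ps_phiZ ps_phi1 //.
  case: (hp) (hq) => _ -> [_ ->].
  rewrite (@ps_phi_alternating true (q * p)) ?mulr1 ?mulr0 ?addr0 //.
  apply: (alternating_seriesM (e := false)) hp.
  exact: alternating_series_one.
have -> : b * geometric u * a = b * (geometric u - 1) * a + b * a.
  by rewrite mulrBr mulr1 mulrBl subrK.
rewrite ps_phiD hba.
rewrite /a mulrDr mulr_algr -scalerAr ps_phiD !ps_phiZ.
rewrite (ps_phi_alternating hS alt_bg).
rewrite (@ps_phi_alternating true (_ * p)) ?mulr0 ?addr0 ?add0r //.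
exact: (alternating_seriesM (e := false)).
Qed.

End Alternating.

(** * Multiplicativity *)

(** The series [chi = w * k] with [k = 1 / ((1 + w) * T_x)] inverts the moment
    series of [x]. *)
Lemma moment_comp (t : A -> seq A -> R[i]) (x : A) (k : pseries R[i]) :
  phi 1 = 1 -> t_coefficients phi t -> phi x != 0 ->
  k * (1 + psX) * (T_transform t x : pseries R[i]) = 1 ->
  ps_comp (fun n => phi (x ^+ n)) (psX * k) = 1 + psX.
Proof.
move=> phi1 ht x0 kE; rewrite -(@forest_comp _ (T_transform t x) (psX * k)).
- by congr ps_comp; apply/funext => n; exact: moment_forests.
- by rewrite mulsE0 mul0r.
by rewrite -!mulrA [k * _]mulrA kE mulr1.
Qed.

(** Let [a] and [b] be the resolvents of [X] and [Y] at [w * k] and [w * l].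
    The hypotheses say that [phi] maps both to [1 + w], so that each is
    [1 + w] plus [w] times a centered series, [p] or [q].  The resolvent of
    [X * Y] at [s] is, up to a scalar, [b] times a geometric series in
    [p * q] times [a], and freeness kills every alternating product of [p] and
    [q]. *)
Lemma free_comp_mul (S : bool -> set A) (X Y : A) (k l : pseries R[i]) :
  phi 1 = 1 -> (forall e, subalgebra (S e)) -> free_family phi S ->
  S true X -> S false Y ->
  ps_comp (fun n => phi (X ^+ n)) (psX * k) = 1 + psX ->
  ps_comp (fun n => phi (Y ^+ n)) (psX * l) = 1 + psX ->
  ps_comp (fun n => phi ((X * Y) ^+ n)) (psX * (1 + psX) * k * l) = 1 + psX.
Proof.
move=> phi1 hS hfree SX SY.
set w : pseries R[i] := psX; set x := ps_const X; set y := ps_const Y.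
have w0 (m : pseries R[i]) : (w * m) 0%N = 0 by rewrite mulsE0 mul0r.
have w0s (m : pseries R[i]) (g : pseries A) : ((w * m) *: g) 0%N = 0.
  by rewrite scales0 w0 scale0r.
rewrite -!ps_phi_geometric.
set a := geometric _ => ha; set b := geometric _ => hb.
have aE := left_inverse_resolvent (geometric_mul (w0s k x)).
have bE := right_inverse_resolvent (mul_geometric (w0s l y)).
have aUa := mul_geometric (w0s k x).
rewrite -/a -/b in aE bE aUa.
have xy : ps_const (X * Y) = x * y.
  apply/funext => -[|n]; first by rewrite mulsE0.
  by rewrite mulsE big1 // => -[[|j] _] _ /=; rewrite ?mul0r ?mulr0.
rewrite xy; set s := w * (1 + w) * k * l.
have s0 : (s *: (x * y)) 0%N = 0 by rewrite /s -!mulrA w0s.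
have main := resolvent_product aE bE.
rewrite -/s in main.
set p := k *: (a * x) - 1 in main; set q := l *: (y * b) - 1 in main.
have centered (z c : pseries A) (m : pseries R[i]) e :
    series_in (S e) z -> c = 1 + w *: (m *: z) -> ps_phi c = 1 + w ->
    centered_series S e (m *: z - 1) /\ c = (1 + w)%:A + w *: (m *: z - 1).
  move=> Sz cE phic.
  have cE' : c = (1 + w)%:A + w *: (m *: z - 1).
    by rewrite {1}cE scalerBr scalerDl scale1r addrACA subrr addr0.
  split=> //; split.
    by apply: series_inB => //; [exact: series_inZ | exact: series_in1].
  apply: psX_mulI; rewrite mulr0 -ps_phiZ; apply: (addrI (1 + w)).
  by rewrite addr0 -[RHS]phic cE' ps_phiD !ps_phiZ ps_phi1 // mulr1.
have Sx : series_in (S true) x by exact: series_in_const.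
have Sy : series_in (S false) y by exact: series_in_const.
have Sa : series_in (S true) a.
  by apply: series_in_geometric => //; exact: series_inZ.
have Sb : series_in (S false) b.
  by apply: series_in_geometric => //; exact: series_inZ.
have [pc aE'] := centered _ _ _ true (series_inM (hS true) Sa Sx) aE ha.
have [qc bE'] := centered _ _ _ false (series_inM (hS false) Sy Sb) bE hb.
rewrite -/p in pc aE'; rewrite -/q in qc bE'.
have [v vE] : exists v : pseries R[i], (1 + w) * v = 1.
  by apply: ps_inv; rewrite addsE /= addr0 oner_neq0.
have wv0 : (w * v) 0%N = 0 := w0 v.
set g := geometric ((w * v) *: (p * q)).
have gE : (1 - (w * v) *: (p * q)) * g = 1.
  by apply: mul_geometric; rewrite scales0 wv0 scale0r.
(* Up to the scalar [1 + w], the resolvent of [X * Y] is [b * g * a]. *)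
have bga : b * g * a = (1 + w) *: geometric (s *: (x * y)).
  have E : (1 - s *: (x * y)) * (b * g * a) = (1 + w)%:A.
    rewrite -[LHS](mul1r (_ * _)) -[X in X * _]aUa -mulrA.
    have -> : a * ((1 - s *: (x * y)) * (b * g * a)) = (1 + w) *: a.
      rewrite !mulrA main.
      have -> : (1 + w)%:A - w *: (p * q) = (1 + w) *: (1 - (w * v) *: (p * q)).
        by rewrite scalerBr scalerA mulrCA vE mulr1.
      by rewrite -scalerAl gE -scalerAl mul1r.
    by rewrite -scalerAr aUa.
  by rewrite -[LHS]mul1r -(geometric_mul s0) -mulrA E mulr_algr.
have := ps_phi_sandwich w (1 + w) phi1 hfree wv0 pc qc.
rewrite -aE' -bE' -/g bga ps_phiZ => /(congr1 (fun m => v * m)).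
by rewrite !mulrA [v * _]mulrC vE !mul1r.
Qed.

Lemma phi_free_mul (S : bool -> set A) (X Y : A) :
  phi 1 = 1 -> (forall e, subalgebra (S e)) -> free_family phi S ->
  S true X -> S false Y -> phi (X * Y) = phi X * phi Y.
Proof.
move=> phi1 hS hfree SX SY.
have cS e Z : S e Z -> S e (Z - phi Z *: 1) /\ phi (Z - phi Z *: 1) = 0.
  move=> SZ; split; last by rewrite linearB linearZ /= phi1 mulr1 subrr.
  apply: subalgebraD => //; rewrite -scaleNr; apply: subalgebraZ => //.
  by case: (hS e).
have [SX0 X0] := cS _ _ SX; have [SY0 Y0] := cS _ _ SY.
have : phi ((X - phi X *: 1) * (Y - phi Y *: 1)) = 0.
  apply: (phi_alternating (e := false) hfree).
  by apply: (alternating_mul (e := true)) => //; exact: alternating_one.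
rewrite !mulrBl !mulrBr -!scalerAl !mul1r -!scalerAr !mulr1 !linearB !linearZ /= phi1.
move=> H; apply/eqP; rewrite -subr_eq0 -[X in _ == X]H; apply/eqP.
by rewrite /GRing.scale /=; ring.
Qed.

End Freeness.

Lemma inverse_mul_uniq (K : comNzRingType) (v k l a b c : K) :
  k * v * a = 1 -> l * v * b = 1 -> v * k * l * v * c = 1 -> c = a * b.
Proof.
move=> ka lb klc; have -> : c = (k * v * a) * (l * v * b) * c.
  by rewrite ka lb !mul1r.
by rewrite -[RHS]mulr1 -klc; ring.
Qed.

Theorem theorem3p2 (R : realType) (A : algType R[i])
    (star : option (A -> A)) (phi : {scalar A})
    (hphi : nc_probability_space star phi)
    (t : A -> seq A -> R[i]) (ht : t_coefficients phi t)
    (X Y : A) (hX : phi X != 0) (hY : phi Y != 0)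
    (hfree : free_pair star phi X Y) :
  T_transform t (X * Y) = fps_mul (T_transform t X) (T_transform t Y).
Proof.
have phi1 : phi 1 = 1 by case: hphi.
pose S (e : bool) := generated_subalgebra star [set (if e then X else Y)]%classic.
have hS e : subalgebra (S e).
  by case: (generated_subalgebraP star [set (if e then X else Y)]%classic).
have SX : S true X.
  by case: (generated_subalgebraP star [set X]%classic) => _; apply.
have SY : S false Y.
  by case: (generated_subalgebraP star [set Y]%classic) => _; apply.
have phiXY : phi (X * Y) = phi X * phi Y by exact: phi_free_mul hS hfree SX SY.
have hXY : phi (X * Y) != 0 by rewrite phiXY mulf_neq0.
pose w : pseries R[i] := psX.
have inv Z : phi Z != 0 ->
    exists k : pseries R[i], k * (1 + w) * (T_transform t Z : pseries R[i]) = 1.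
  move=> Z0; have [|k kE] := @ps_inv _ ((1 + w) * (T_transform t Z : pseries R[i])).
    rewrite mulsE0 addsE /= addr0 mul1r /T_transform /=.
    have := moment_forests 1 phi1 ht Z0.
    rewrite big_seq1 /forest_weight big_ord1 expr1.
    by rewrite -[T_transform _ _ _]/(t Z [::]) => <-.
  by exists k; rewrite -mulrA mulrC.
have [k kE] := inv _ hX; have [l lE] := inv _ hY; have [m mE] := inv _ hXY.
have XE := moment_comp phi1 ht hX kE.
have YE := moment_comp phi1 ht hY lE.
have XYE := moment_comp phi1 ht hXY mE.
have XYE' := free_comp_mul phi1 hS hfree SX SY XE YE.
have chiE : w * m = w * (1 + w) * k * l.
  apply: (ps_comp_inj _ _ _ (etrans XYE (esym XYE'))).
  - by rewrite expr1.
  - by rewrite mulsE0 mul0r.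
  - by rewrite -!mulrA mulsE0 mul0r.
have mE' : m = (1 + w) * k * l by apply: psX_mulI; rewrite !mulrA.
apply: (inverse_mul_uniq kE lE).
by rewrite -mE'.
Qed.
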